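(* Let $s \in \mathbb{R}$ and let $Y_s$ be a real random variable whose quantile function is $Q(p;s) = \mathrm{Li}_s(p)$. Then $$E[Y_s] = \begin{cases} \displaystyle\sum_{k=1}^{\infty} \frac{1}{k^s (k+1)}, & \text{if } s > 0, \\ \infty, & \text{if } s \le 0, \end{cases}$$ where the series converges for every $s > 0$.
   Context: For $s \in \mathbb{R}$ and $p \in [0,1]$, the polylogarithm is $\mathrm{Li}_s(p) = \sum_{k=1}^{\infty} \frac{p^k}{k^s}$; the series converges except when $p = 1$ and $s \le 1$, in which case the value is taken to be $+\infty$. The quantile function of a random variable is its inverse cumulative distribution function $Q = F^{-1}$; that $Y_s$ has quantile function $\mathrm{Li}_s$ means that $Y_s$ has the same distribution as $\mathrm{Li}_s(X)$, where $X$ is uniformly distributed on $[0,1]$. In particular $Y_s$ is non-negative, so its expectation is always defined in $[0,\infty]$. *)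

(* Defs.v *)
From HB Require Import structures.
From mathcomp Require Import all_boot all_order all_algebra.
From mathcomp Require Import all_classical all_reals all_analysis.
From mathcomp Require Import measurable_realfun.
Import Order.TTheory GRing.Theory Num.Theory.
Import numFieldNormedType.Exports.

Set Implicit Arguments.
Unset Strict Implicit.
Unset Printing Implicit Defensive.

Local Open Scope classical_set_scope.
Local Open Scope ring_scope.
Local Open Scope ereal_scope.

(* The polylogarithm Li_s(p), meaningful for 0 <= p <= 1 only.  There the terms
   are nonnegative, so the extended-real sum always exists: it is the usual sum
   when the series converges, and +oo when it diverges (p = 1 and s <= 1). *)
Definition polylog {R : realType} (s p : R) : \bar R :=
  \sum_(1 <= k <oo) (p ^+ k / k%:R `^ s)%:E.

(* Y has quantile function Q on [0, 1]: Y has the same distribution as Q(X),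
   where X is uniformly distributed on [0, 1].  The law of Q(X) depends only on
   that of X, so X is taken to be the identity on R equipped with the uniform
   probability.  Since Q may take infinite values (as Li_s(1) does for s <= 1),
   the two laws are compared on the Borel sets of \bar R; the intersection with
   [0, 1] makes the values of Q elsewhere irrelevant. *)
Definition has_quantile_function {d : measure_display} {T : measurableType d}
    {R : realType} (P : probability T R) (Y : {RV P >-> R})
    (Q : R -> \bar R) : Prop :=
  forall A : set (\bar R), measurable A ->
    P [set w | A (Y w)%:E] =
    uniform_prob (@ltr01 R) (`[0%R, 1%R] `&` Q @^-1` A).

(* Main.v *)
Require Import Defs.
From HB Require Import structures.
From mathcomp Require Import all_boot all_order all_algebra.
From mathcomp Require Import all_classical all_reals all_analysis.
From mathcomp Require Import measurable_realfun.
From mathcomp Require Import ring lra.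
Import Order.TTheory GRing.Theory Num.Theory.
Import numFieldNormedType.Exports.

(** If X is uniform on [0, 1] and Y has the law of Q(X), then E[Y] is the
    integral of Q over [0, 1] ([expectation_quantile]).  The terms of Li_s are
    nonnegative on [0, 1], so monotone convergence allows term-by-term
    integration; since x^k has integral 1/(k+1), this gives
      E[Y_s] = \sum_(k >= 1) 1 / (k^s (k+1))
    in [0, +oo] for every real s ([integral_polylog]).

    What remains is the nature of this series.  For s <= 0 we have k^s <= 1, so
    it dominates the harmonic series.  For s > 0 its k-th term is at most
    (1+s)/s times k^-s - (k+1)^-s ([polylog_mean_le_telescope]), so that the
    partial sums telescope to a quantity below (1+s)/s. *)

Set Implicit Arguments.
Unset Strict Implicit.
Unset Printing Implicit Defensive.

Local Open Scope classical_set_scope.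
Local Open Scope ring_scope.
Local Open Scope ereal_scope.

Lemma uniform_prob_setIitv (R : realType) (a b : R) (ab : (a < b)%R)
    (U : set R) :
  uniform_prob ab (`[a, b] `&` U) = uniform_prob ab U.
Proof.
by rewrite /uniform_prob integral_uniform_pdf setIC setIA setIid setIC
  -integral_uniform_pdf.
Qed.

(** Both sides are integrals of g over \bar R: on the left against the law of Y,
    on the right against the law of Q(X).  By hypothesis the two laws agree on
    Borel sets.  As Q is only known to be measurable on [0, 1], it is extended
    by 0 to the whole line; the uniform probability does not see the change. *)
Lemma ge0_integral_quantile (R : realType) (d : measure_display)
    (T : measurableType d) (P : probability T R) (Y : {RV P >-> R})
    (Q : R -> \bar R)
    (g : \bar R -> \bar R) :
  has_quantile_function Y Q -> measurable_fun (`[0%R, 1%R] : set R) Q ->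
  measurable_fun setT g -> (forall y, 0 <= g y) ->
  \int[P]_w g (Y w)%:E =
  \int[@lebesgue_measure R]_(x in `[0%R, 1%R]) g (Q x).
Proof.
move=> YQ mQ mg g0.
have mY : measurable_fun setT (EFin \o Y) by exact/measurable_EFinP.
have mQ1 : measurable_fun setT (Q \_ `[0%R, 1%R]).
  by move: mQ; apply: (measurable_restrictT _ _).1.
transitivity (\int[pushforward P (EFin \o Y)]_y g y).
  by rewrite ge0_integral_pushforward.
transitivity (\int[pushforward (uniform_prob (@ltr01 R)) (Q \_ `[0%R, 1%R])]_y
    g y).
  apply: eq_measure_integral => A mA _.
  rewrite /= /pushforward -[RHS]uniform_prob_setIitv.
  rewrite [LHS](YQ A mA); congr (uniform_prob _ _).
  apply/seteqP; split => x [x01] /=; rewrite patchE mem_set//.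
rewrite ge0_integral_pushforward// integral_uniform//; last 2 first.
- exact: (measurableT_comp mg mQ1).
- by move=> x /=.
rewrite subr0 invr1 mul1e.
by apply: eq_integral => x x01 /=; rewrite patchE x01.
Qed.

(** The integral of a signed function is the difference of the integrals of its
    positive and negative parts, and each part is a nonnegative function of the
    value, to which the transfer above applies. *)
Lemma expectation_quantile (R : realType) (d : measure_display)
    (T : measurableType d) (P : probability T R) (Y : {RV P >-> R})
    (Q : R -> \bar R) :
  has_quantile_function Y Q -> measurable_fun (`[0%R, 1%R] : set R) Q ->
  'E_P[Y] = \int[@lebesgue_measure R]_(x in `[0%R, 1%R]) Q x.
Proof.
move=> YQ mQ; rewrite expectation_def [LHS]integralE [RHS]integralE.
congr (_ - _).
- have mg : measurable_fun setT (id^\+ : \bar R -> \bar R).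
    exact: measurable_funepos.
  transitivity (\int[P]_w id^\+ (Y w)%:E).
    by apply: eq_integral => w _; rewrite !funeposE.
  rewrite (ge0_integral_quantile YQ mQ mg)//.
  by apply: eq_integral => x _; rewrite !funeposE.
- have mg : measurable_fun setT (id^\- : \bar R -> \bar R).
    exact: measurable_funeneg.
  transitivity (\int[P]_w id^\- (Y w)%:E).
    by apply: eq_integral => w _; rewrite !funenegE.
  rewrite (ge0_integral_quantile YQ mQ mg)//.
  by apply: eq_integral => x _; rewrite !funenegE.
Qed.

Lemma integral01_exprn (R : realType) (k : nat) (c : R) :
  \int[lebesgue_measure]_(x in `[0%R, 1%R]) (x ^+ k / c)%:E =
  ((c * k.+1%:R)^-1)%:E.
Proof.
pose F (x : R) : R := (x ^+ k.+1 * (c * k.+1%:R)^-1)%R.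
have cF : continuous F.
  by move=> x; apply: cvgM; [exact: exprn_continuous|exact: cvg_cst].
rewrite (@continuous_FTC2 _ _ F)//.
- by rewrite /F expr1n expr0n/= mul1r mul0r sube0.
- apply: continuous_subspaceT => x.
  by apply: cvgM; [exact: exprn_continuous|exact: cvg_cst].
- split.
  + by move=> x _; apply: derivableM => //; exact: exprn_derivable.
  + exact/cvg_at_right_filter/cF.
  + exact/cvg_at_left_filter/cF.
- move=> x _; rewrite derive1Mr; last exact: exprn_derivable.
  rewrite exp_derive1 /= invfM; move: c^-1%R => ci.
  by rewrite [(_ *: _)%R]mulrC mulrACA mulfV ?mulr1.
Qed.

Section polylog_integral.
Context {R : realType} (s : R).

Let f (k : nat) (x : R) : \bar R := (x ^+ k.+1 / k.+1%:R `^ s)%:E.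

Let f_ge0 k x : x \in `[0%R, 1%R] -> 0 <= f k x.
Proof.
rewrite in_itv/= => /andP[x0 _].
by rewrite lee_fin mulr_ge0 ?exprn_ge0 ?invr_ge0 ?powR_ge0.
Qed.

Let mf k : measurable_fun (`[0%R, 1%R] : set R) (f k).
Proof.
by apply/measurable_EFinP/measurable_funM => //; exact: exprn_measurable.
Qed.

Let polylogE x : x \in `[0%R, 1%R] -> polylog s x = \sum_(k <oo) f k x.
Proof.
rewrite in_itv/= => /andP[x0 _].
rewrite /polylog -nneseries_addn.
  by apply: eq_eseriesr => k _; rewrite addn1.
by move=> k; rewrite lee_fin mulr_ge0 ?exprn_ge0 ?invr_ge0 ?powR_ge0.
Qed.

Lemma measurable_polylog : measurable_fun (`[0%R, 1%R] : set R) (polylog s).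
Proof.
apply: (eq_measurable_fun (fun x => \sum_(k <oo) f k x)).
  by move=> x /[!inE] x01; rewrite polylogE.
by apply: ge0_emeasurable_sum => // k x x01 _; exact: f_ge0.
Qed.

Lemma integral_polylog :
  \int[lebesgue_measure]_(x in `[0%R, 1%R]) polylog s x =
  \sum_(1 <= k <oo) ((k%:R `^ s * k.+1%:R)^-1)%:E.
Proof.
transitivity (\int[@lebesgue_measure R]_(x in `[0%R, 1%R])
    \sum_(k <oo) f k x).
  by apply: eq_integral => x /[!inE] x01; rewrite polylogE.
rewrite integral_nneseries//.
rewrite -[RHS](@nneseries_addn _ _ 1); last first.
  by move=> k; rewrite lee_fin invr_ge0 mulr_ge0 ?powR_ge0.
by apply: eq_eseriesr => k _; rewrite integral01_exprn addn1.
Qed.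

End polylog_integral.

(** A nondecreasing real sequence without a limit tends to +oo, and for partial
    sums divergence does not depend on where the summation starts. *)
Lemma nneseries_dvg (R : realType) (u : nat -> R) (N : nat) :
  (forall k, 0 <= u k)%R -> ~ cvgn (series u) ->
  \sum_(N <= k <oo) (u k)%:E = +oo.
Proof.
move=> u0; rewrite -(is_cvg_series_restrict N) => /nondecreasing_dvgn_lt uoo.
apply/cvg_lim => //; under eq_fun do rewrite sumEFin.
apply/cvgeryP/uoo => m n mn.
by rewrite -lee_fin -!sumEFin; apply: lee_sum_nneg_natr => // k _ _; rewrite lee_fin.
Qed.

Lemma nneseries_polylog_mean_dvg (R : realType) (s : R) : (s <= 0)%R ->
  \sum_(1 <= k <oo) ((k%:R `^ s * k.+1%:R)^-1)%:E = +oo.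
Proof.
move=> s0; apply/eqP; rewrite -leye_eq.
rewrite -(@nneseries_dvg _ harmonic 1 (@harmonic_ge0 R) (@dvg_harmonic R)).
rewrite -[leLHS](@nneseries_addn _ _ 1); last first.
  by move=> k; rewrite lee_fin; exact: harmonic_ge0.
rewrite -[leRHS](@nneseries_addn _ _ 1); last first.
  by move=> k; rewrite lee_fin invr_ge0 mulr_ge0 ?powR_ge0.
apply: lee_nneseries => [k _ _|k _].
  by rewrite lee_fin; exact: harmonic_ge0.
rewrite addn1 lee_fin /harmonic/= lef_pV2 ?posrE ?mulr_gt0 ?powR_gt0//.
by rewrite ler_piMl// -[leRHS](powRr0 k.+1%:R) ler_powR// ler1n.
Qed.

(** Writing ((k+1)/k)^s = exp (- s * ln (k/(k+1))), the bound comes from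
    ln (1 - 1/(k+1)) <= - 1/(k+1) followed by 1 + x <= exp x. *)
Lemma powR_succ_ge (R : realType) (s : R) (k : nat) :
  (0 <= s)%R -> (0 < k)%N ->
  (k%:R `^ s * (1 + s / k.+1%:R) <= k.+1%:R `^ s)%R.
Proof.
move=> s0 k0; have kR : (0 < k%:R :> R)%R by rewrite ltr0n.
have k1R : (0 < k.+1%:R :> R)%R by rewrite ltr0n.
rewrite /powR !gt_eqF//.
rewrite [in leRHS](_ : s * ln k.+1%:R =
  s * ln k%:R + s * (ln k.+1%:R - ln k%:R))%R; last by ring.
rewrite expRD ler_pM2l ?expR_gt0//.
apply: le_trans (expR_ge1Dx _).
rewrite lerD2l ler_wpM2l// -lerN2 opprB -ln_div ?posrE//.
rewrite (_ : k%:R / k.+1%:R = 1 + - k.+1%:R^-1 :> R)%R.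
  by apply: le_ln1Dx; rewrite ltrN2 invf_lt1// ltr1n.
by rewrite -natr1; field; rewrite natr1 gt_eqF.
Qed.

(** With A = k^s, B = (k+1)^s and K = k+1, the previous lemma reads
    A (1 + s/K) <= B, hence
      1/A - 1/B >= 1/A - 1/(A (1 + s/K)) = s / (A (K + s)),
    and K + s <= K (1 + s) because K >= 1. *)
Lemma polylog_mean_le_telescope (R : realType) (s : R) (k : nat) :
  (0 < s)%R -> (0 < k)%N ->
  ((k%:R `^ s * k.+1%:R)^-1 <=
   (1 + s) / s * ((k%:R `^ s)^-1 - (k.+1%:R `^ s)^-1))%R.
Proof.
move=> s0 k0; have := @powR_succ_ge R s k (ltW s0) k0.
have A0 : (0 < k%:R `^ s :> R)%R by rewrite powR_gt0// ltr0n.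
have K1 : (1 <= k.+1%:R :> R)%R by rewrite ler1n.
set A := (k%:R `^ s)%R in A0 *; set B := (k.+1%:R `^ s)%R.
set K : R := k.+1%:R in K1 *.
move=> AB.
have K0 : (0 < K)%R by lra.
have D0 : (0 < 1 + s / K)%R by rewrite ltr_wpDr// ltW// divr_gt0.
have BV : (B^-1 <= (A * (1 + s / K))^-1)%R.
  rewrite lef_pV2 ?posrE ?mulr_gt0//.
  by apply: lt_le_trans AB; rewrite mulr_gt0.
have KsK : (K + s <= K * (1 + s))%R by rewrite mulrDr mulr1 lerD2l ler_peMl// ltW.
apply: (@le_trans _ _ ((1 + s) / s * (A^-1 - (A * (1 + s / K))^-1))%R); last first.
  by rewrite ler_wpM2l ?lerB// divr_ge0//; lra.
rewrite (_ : (1 + s) / s * (A^-1 - (A * (1 + s / K))^-1) =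
  A^-1 * ((1 + s) / (K + s)))%R; last first.
  by field; rewrite !gt_eqF//; lra.
rewrite invfM ler_wpM2l ?invr_ge0 ?(ltW A0)//.
by rewrite ler_pdivlMr ?addr_gt0// mulrC ler_pdivrMr// mulrC.
Qed.

Lemma cvgn_polylog_mean (R : realType) (s : R) : (0 < s)%R ->
  cvgn (fun n : nat =>
    (\sum_(1 <= k < n) (k%:R `^ s * (k.+1)%:R)^-1)%R : R).
Proof.
move=> s0; apply: nondecreasing_is_cvgn.
  move=> m n mn; rewrite -lee_fin -!sumEFin.
  by apply: lee_sum_nneg_natr.
have C0 : (0 <= (1 + s) / s)%R by rewrite divr_ge0//; lra.
exists ((1 + s) / s)%R => _ [n _ <-].
have [n1|n1] := leqP n 1; first by rewrite big_geq.
apply: le_trans (_ : \sum_(1 <= k < n)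
    (1 + s) / s * ((k%:R `^ s)^-1 - (k.+1%:R `^ s)^-1) <= _)%R.
  rewrite !big_nat; apply: ler_sum => k /andP[k1 _].
  exact: polylog_mean_le_telescope.
rewrite -mulr_sumr ler_piMr//.
under eq_bigr do rewrite -opprB.
rewrite sumrN (telescope_sumr (fun k => (k%:R `^ s)^-1)%R (ltnW n1)).
by rewrite opprB powR1 invr1 lerBlDr lerDl invr_ge0 powR_ge0.
Qed.

Theorem mainTheorem2 (R : realType) (d : measure_display)
    (T : measurableType d) (P : probability T R) (s : R)
    (Y : {RV P >-> R}) (hY : has_quantile_function Y (polylog s)) :
  'E_P[Y] = (if (0 < s)%R
             then \sum_(1 <= k <oo) ((k%:R `^ s * (k.+1)%:R)^-1)%:E
             else +oo)
  /\
  ((0 < s)%R ->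
    cvgn (fun n : nat => (\sum_(1 <= k < n) (k%:R `^ s * (k.+1)%:R)^-1)%R : R)).
Proof.
split; last exact: cvgn_polylog_mean.
rewrite (expectation_quantile hY (measurable_polylog s)) integral_polylog.
by case: ltP => // /nneseries_polylog_mean_dvg.
Qed.
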